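(* Let $T$ be a non-star tree and let $x$ be any vertex of $T$. Then there exists a $(T,x)$-well 2-placement.
   Context: All graphs are finite, simple and undirected; $dist$ denotes distance in $T$ and $d(y)$ the degree of $y$ in $T$. A non-star tree is a tree that is not isomorphic to a star $K_{1,m}$ for any $m\ge 0$ (so it has at least $4$ vertices). A permutation $\sigma$ of $V(T)$ is a 2-placement of $T$ if for every edge $ab\in E(T)$, $\sigma(a)\sigma(b)\notin E(T)$. $T^k$ denotes the $k$-th power of $T$; $\sigma(T)\subseteq T^k$ means that for every edge $ab$ of $T$, $dist(\sigma(a),\sigma(b))\le k$. Cycles of $\sigma$ are those of its disjoint cycle decomposition. For a non-star tree $T$ and a vertex $x$, a fixed-point-free permutation $\sigma$ of $V(T)$ is a $(T,x)$-well 2-placement if: (1) $\sigma$ is a 2-placement of $T$; (2) $\sigma(T)\subseteq T^6$; (3) $dist(x,\sigma(x))\le 2$; (4) $dist(y,\sigma(y))\le 3$ for every neighbor $y$ of $x$; (5) $dist(y,\sigma(y))\le 4$ for every $y$ with $d(y)=1$; (6) every cycle of $\sigma$ has length at most $5$. *)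

(* Defs.v *)
From mathcomp Require Import all_boot all_fingroup.
Set Implicit Arguments. Unset Strict Implicit. Unset Printing Implicit Defensive.

Section Graphs.
Variable V : finType.
Variable e : rel V.

Definition simple_graph : Prop := symmetric e /\ irreflexive e.

(* within k x y  <=>  dist(x,y) <= k  (there is a walk of length <= k). *)
Fixpoint within (k : nat) (x y : V) : bool :=
  match k with
  | 0 => x == y
  | k'.+1 => within k' x y || [exists z, e x z && within k' z y]
  end.

Definition deg (y : V) : nat := #|[set z | e y z]|.

Definition is_tree : Prop :=
  simple_graph /\
  (forall x y : V, connect e x y) /\
  (forall c : seq V, 2 < size c -> ~ ucycle e c).

(* the graph is isomorphic to a star K_{1,m} (m >= 0): there is a centre c,
   adjacent to every other vertex, and no other edges. *)
Definition is_star : Prop :=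
  exists c : V, forall u v : V,
    e u v = ((u == c) && (v != c)) || ((v == c) && (u != c)).

Definition non_star_tree : Prop := is_tree /\ ~ is_star.

Definition two_placement (s : {perm V}) : Prop :=
  forall a b : V, e a b -> ~~ e (s a) (s b).

Definition well_2_placement (x : V) (s : {perm V}) : Prop :=
  (forall v : V, s v != v) /\
  two_placement s /\
  (forall a b : V, e a b -> within 6 (s a) (s b)) /\
  within 2 x (s x) /\
  (forall y : V, e x y -> within 3 y (s y)) /\
  (forall y : V, deg y = 1 -> within 4 y (s y)) /\
  (forall v : V, #|porbit s v| <= 5).

End Graphs.

(* Main.v *)
Require Import Defs.
From mathcomp Require Import all_boot all_fingroup zify.
Set Implicit Arguments. Unset Strict Implicit. Unset Printing Implicit Defensive.

(** Root [T] at [x]. Call a vertex [v] of type 0 when the subtrees of its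
children can be placed among themselves, i.e. independently of the rest of the
tree, with each child [c] of [v] sent to distance at most 2 from [v]; and of type
[k+1] when this holds after removal of one child, which is itself of type [k].
Two or three children of types 0, 1, 2 can be placed together, and so can a single
child of type 3, because the path with four vertices has a 2-placement. Grouping
the children of type at most 2 by twos and threes leaves none over unless there is
exactly one of them, so by induction every vertex has a type at most 3.

In a non-star tree, [x] is one of the first two vertices of an induced path with
four vertices, which together with the descending chains witnessing the types of
its vertices forms a comb with one of 256 shapes. An explicit placement of each
comb, moving [x] by at most 2, the neighbours of [x] by at most 3 and the other
vertices by at most 4, extends to the subtrees hanging from the comb: a vertex
moved by at most 4, and its child sent to distance at most 2 from it, end up at
distance at most 6. *)

(** * Walks and rooted trees *)

Section Within.
Variables (V : finType) (e : rel V).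

Lemma within_refl k v : within e k v v.
Proof. by elim: k => [|k IHk] /=; rewrite ?eqxx ?IHk. Qed.

Lemma within1 a b : e a b -> within e 1 a b.
Proof. by move=> eab /=; apply/orP; right; apply/existsP; exists b; rewrite eab /=. Qed.

Lemma within_leq k l a b : k <= l -> within e k a b -> within e l a b.
Proof.
move=> /subnKC <-; elim: (l - k) => [|n IHn] wab; first by rewrite addn0.
by rewrite addnS /= IHn.
Qed.

Lemma within_trans k l a b c :
  within e k a b -> within e l b c -> within e (k + l) a c.
Proof.
elim: k a => [|k IHk] a /= => [/eqP-> //|/orP[wab|/existsP[z /andP[eaz wzb]]] wbc].
  by rewrite (IHk _ wab wbc).
by apply/orP; right; apply/existsP; exists z; rewrite eaz IHk.
Qed.

Lemma within_sym k : symmetric e -> symmetric (within e k).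
Proof.
move=> sym_e; suff imp a b : within e k a b -> within e k b a.
  by move=> a b; apply/idP/idP; apply: imp.
elim: k a => [|k IHk] a /= => [/eqP-> //|/orP[/IHk->//|/existsP[z /andP[eaz]]]].
move/IHk=> wbz; have: within e (k + 1) b a.
  by apply: within_trans wbz _; apply: within1; rewrite sym_e.
by rewrite addn1.
Qed.

End Within.

(** Reducing an exponent modulo the period [k] does not change the iterate at [v], so exponents
    below [k] already give the whole orbit. *)
Lemma porbit_leq (T : finType) (s : {perm T}) v k :
  0 < k -> iter k s v = v -> #|porbit s v| <= k.
Proof.
move=> k_gt0 skv.
apply: (@leq_trans #|[set iter (i : 'I_k) s v | i : 'I_k]|); last first.
  by rewrite (leq_trans (leq_imset_card _ _)) // card_ord.
apply/subset_leq_card/subsetP => y /porbitP[i ->]; rewrite permX.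
apply/imsetP; exists (Ordinal (ltn_pmod i k_gt0)) => //=.
rewrite {1}(divn_eq i k) addnC iterD; congr iter.
by elim: (i %/ k) => //= m IHm; rewrite mulSn iterD IHm.
Qed.

Section Rooting.
Variables (V : finType) (e : rel V) (x : V).

(** The root is its own parent by convention. [rk] need not be the depth: it only has to decrease
    towards the root, which makes climbing terminate. *)
Definition rooting (A : {set V}) (par : V -> V) (rk : V -> nat) :=
  [/\ x \in A, par x = x,
      {in A, forall v, v != x -> par v \in A /\ rk (par v) < rk v}
    & {in A &, forall a b,
        e a b = (a != x) && (par a == b) || (b != x) && (par b == a)}].

Definition restrict (A : {set V}) : rel V :=
  [rel a b | [&& a \in A, b \in A & e a b]].

(** Climbing along [par] joins every vertex of [A] to [x] without leaving [A]. The resulting path is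
    the one closed into a cycle when [A] is extended. *)
Lemma rooting_connect (A : {set V}) par rk : symmetric e -> rooting A par rk ->
  {in A &, forall a b, connect (restrict A) a b}.
Proof.
move=> sym_e [xA parx parA eE].
have symA : connect_sym (restrict A).
  by apply: sym_connect_sym => a b; rewrite /restrict /= sym_e andbCA.
suff toroot a : a \in A -> connect (restrict A) x a.
  by move=> a b aA bA; apply: connect_trans (toroot b bA); rewrite symA toroot.
have [n] := ubnP (rk a); elim: n a => // n IHn a lt_an aA.
have [-> //|ax] := eqVneq a x.
have [pA ltp] := parA a aA ax.
apply: connect_trans (IHn _ _ pA) _; first by rewrite (leq_trans ltp).
by apply: connect1; rewrite /restrict /= aA pA eE // ax eqxx orbT.
Qed.

(* A vertex outside [A] with two neighbours in [A] would close a cycle. *)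
Lemma rooting_extend (A : {set V}) par rk : is_tree e -> rooting A par rk ->
  A != setT -> exists b par' rk', b \notin A /\ rooting (b |: A) par' rk'.
Proof.
move=> [[sym_e irr_e] [conn acyc]] rA; have [xA parx parA eE] := rA.
rewrite -subTset => /subsetPn[b0 _ b0A].
have [a [b [aA bA eab]]] : exists a b, [/\ a \in A, b \notin A & e a b].
  have [/existsP[a /andP[aA /existsP[b /andP[]]]]|noe] :=
    boolP [exists a, (a \in A) && [exists b, (b \notin A) && e a b]].
    by exists a, b.
  case/connectP: (conn x b0) b0A => p; elim: p (x) xA => /= [|c p IHp] a aA.
    by move=> _ ->; rewrite aA.
  case/andP=> eac; apply: IHp; apply: contraR noe => cA.
  by apply/existsP; exists a; rewrite aA; apply/existsP; exists c; rewrite cA.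
have uniq_a a' : a' \in A -> e a' b -> a' = a.
  move=> a'A ea'b; apply/eqP; apply/idPn => neq_a.
  have /connectP[p0 p0P] := rooting_connect sym_e rA aA a'A.
  case/shortenP: p0P => p pP Up _ def_a'.
  have inA : {subset a :: p <= A}.
    move=> z; rewrite inE => /predU1P[-> //|].
    by elim: p (a) pP {Up def_a'} => //= c p IHp u /andP[/and3P[_ cA _]] /IHp{}IHp;
       rewrite inE => /predU1P[->|].
  apply: (acyc (b :: a :: p)).
    by case: p def_a' {pP Up inA} neq_a => //= ->; rewrite eqxx.
  apply/andP; split; last by rewrite cons_uniq Up (contra (inA b)).
  rewrite /= rcons_path -def_a' ea'b sym_e eab andbT.
  by apply: sub_path pP => u v /and3P[].
have bx : b != x by apply: contraNneq bA => ->.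
pose par' v := if v == b then a else par v.
pose rk' v := if v == b then (rk a).+1 else rk v.
have A_b v : v \in A -> (v == b) = false by apply: contraTF => /eqP->.
exists b, par', rk'; split=> //; split.
- by rewrite !inE xA orbT.
- by rewrite /par' eq_sym (negPf bx).
- move=> v; rewrite !inE /par' /rk' => /predU1P[-> _|vA vx].
    by rewrite eqxx A_b // aA orbT.
  by have [pA lt] := parA v vA vx; rewrite !A_b // pA orbT.
- move=> u v; rewrite !inE /par' => /predU1P[->|uA] /predU1P[->|vA].
  + by rewrite irr_e eqxx bx A_b.
  + rewrite eqxx bx (A_b v vA) /= sym_e.
    have -> : (v != x) && (par v == b) = false.
      have [//|vx] := eqVneq v x; have [pA _] := parA v vA vx.
      by rewrite A_b.
    rewrite orbF; apply/idP/eqP => [/(uniq_a _ vA)|<-] //.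
  + rewrite eqxx bx (A_b u uA) /=.
    have -> /= : (u != x) && (par u == b) = false.
      have [//|ux] := eqVneq u x; have [pA _] := parA u uA ux.
      by rewrite A_b.
    apply/idP/eqP => [/(uniq_a _ uA)|<-] //.
  + by rewrite (A_b u uA) (A_b v vA) eE.
Qed.

(** The rooted part grows from [[set x]] one vertex at a time; [n] bounds the number of vertices
    still missing. *)
Lemma tree_rooting : is_tree e -> exists par rk, rooting setT par rk.
Proof.
move=> tree_e; have [[_ irr_e] _] := tree_e.
suff grow n (A : {set V}) par rk : #|~: A| <= n -> rooting A par rk ->
    exists par' rk', rooting setT par' rk'.
  apply: (grow _ [set x] id (fun=> 0) (leqnn _)); split; rewrite ?inE // => v.
    by rewrite inE => ->.
  by move=> w; rewrite !inE => /eqP-> /eqP->; rewrite irr_e eqxx.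
elim: n A par rk => [|n IHn] A par rk leA rA.
  have AT : A = setT.
    by apply/eqP; rewrite -subTset -setCS setCT subset0 -cards_eq0 -leqn0.
  by exists par, rk; rewrite -AT.
have [AT|neqA] := eqVneq A setT; first by exists par, rk; rewrite -AT.
have [b [par' [rk' [bA /IHn]]]] := rooting_extend tree_e rA neqA; apply.
move: leA; rewrite (cardsD1 b (~: A)) inE bA add1n ltnS; apply: leq_trans.
by apply/subset_leq_card/subsetP => v; rewrite !inE negb_or.
Qed.

End Rooting.

(** * Partial placements *)

Section Placement.
Variables (V : finType) (e : rel V) (x : V).
Hypothesis sym_e : symmetric e.

(** The bound 4 is imposed on all vertices, not only on leaves, so that subtrees can be attached
    below any vertex already placed. *)
Definition moves_ok (v w : V) :=
  [/\ within e 4 v w, e x v -> within e 3 v w & v = x -> within e 2 v w].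

(* A placement of the subgraph induced by [A]. The walks bounding the displacements
   may leave [A]. *)
Record placement (A : {set V}) (f : V -> V) : Prop := Placement {
  placement_in : {in A, forall v, f v \in A};
  placement_neq : {in A, forall v, f v != v};
  placement_iter : {in A, forall v, exists2 k, 0 < k <= 5 & iter k f v = v};
  placement_edge : {in A &, forall a b,
    e a b -> ~~ e (f a) (f b) /\ within e 6 (f a) (f b)};
  placement_move : {in A, forall v, moves_ok v (f v)} }.

Lemma eq_in_iter (A : {set V}) f g k v : {in A, forall v, f v \in A} ->
  {in A, g =1 f} -> v \in A -> iter k g v = iter k f v /\ iter k f v \in A.
Proof.
move=> fA eq_gf vA; elim: k => //= k [-> kA].
by rewrite eq_gf // fA.
Qed.

(* All edges between [A] and [B] start at [v]; since [f] moves [v] inside [A],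
   their images are not edges. *)
Lemma placementU (A B : {set V}) f g v : placement A f -> placement B g ->
    [disjoint A & B] ->
    {in A & B, forall a b, e a b -> a = v /\ within e 2 v (g b)} ->
  exists h, [/\ placement (A :|: B) h, {in A, h =1 f} & {in B, h =1 g}].
Proof.
move=> [fA fN fI fE fM] [gB gN gI gE gM] dAB eAB.
pose h w := if w \in A then f w else g w.
have hA : {in A, h =1 f} by rewrite /h => w ->.
have hB : {in B, h =1 g} by rewrite /h => w wB; rewrite (disjointFl dAB wB).
have cross a b : a \in A -> b \in B -> e a b ->
    ~~ e (f a) (g b) /\ within e 6 (f a) (g b).
  move=> aA bB eab; have [av wv] := eAB a b aA bB eab; split.
    apply/negP => /(eAB _ _ (fA a aA) (gB b bB))[fav _].
    by have:= fN a aA; rewrite fav av eqxx.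
  (* The walk goes from [f a] back to [a = v] in at most 4 steps, then to [g b] in at most 2. *)
  have [w4 _ _] := fM a aA; apply: (@within_trans _ _ 4 2 _ a).
    by rewrite within_sym.
  by rewrite av.
exists h; split=> //; split=> [w|w|w|a b|w].
- by rewrite !inE => /orP[wA|wB]; [rewrite hA ?fA|rewrite hB ?gB ?orbT].
- by rewrite inE => /orP[wA|wB]; [rewrite hA ?fN|rewrite hB ?gN].
- rewrite inE => /orP[wA|wB].
    have [k k5 fk] := fI w wA; exists k => //.
    by have [-> _] := eq_in_iter k fA hA wA.
  have [k k5 fk] := gI w wB; exists k => //.
  by have [-> _] := eq_in_iter k gB hB wB.
- rewrite !inE => /orP[aA|aB] /orP[bA|bB] eab.
  + by rewrite !hA //; apply: fE.
  + by rewrite hA ?hB //; apply: cross.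
  + rewrite hB ?hA // sym_e within_sym //.
    by apply: cross => //; rewrite sym_e.
  + by rewrite !hB //; apply: gE.
- by rewrite inE => /orP[wA|wB]; [rewrite hA; auto|rewrite hB; auto].
Qed.

(** Injectivity follows from the periods: if [f a = f b], iterating [f] a common positive multiple
    of the periods of [a] and [b] gives the same vertex from both, namely [a] and [b]. *)
Lemma placement_well f :
  placement setT f -> exists s : {perm V}, well_2_placement e x s.
Proof.
move=> [_ fN fI fE fM].
have inj_f : injective f.
  move=> a b fab; have [[|k] // /andP[_ k5] fka] := fI a (in_setT a).
  have [[|l] // /andP[_ l5] flb] := fI b (in_setT b).
  have period m n v : iter m f v = v -> iter (n * m) f v = v.
    by move=> fm; elim: n => //= n IHn; rewrite mulSn iterD IHn.
  rewrite -(period _ l.+1 _ fka) -[RHS](period _ k.+1 _ flb) [k.+1 * _]mulnC.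
  by rewrite mulSn addSn !iterSr fab.
exists (perm inj_f).
have sE : perm inj_f =1 f by move=> v; rewrite permE.
split=> [v|]; first by rewrite sE fN.
split=> [a b eab|]; first by rewrite !sE; have [] := fE a b _ _ eab.
split=> [a b eab|]; first by rewrite !sE; have [] := fE a b _ _ eab.
split; first by rewrite sE; have [_ _ ->] := fM x (in_setT x).
split=> [y exy|]; first by rewrite sE; have [_ -> //] := fM y (in_setT y).
split=> [y _|v]; first by rewrite sE; have [] := fM y (in_setT y).
have [k /andP[k_gt0 k5] fk] := fI v (in_setT v).
by apply: leq_trans k5; apply: porbit_leq => //; rewrite -[RHS]fk; apply: eq_iter.
Qed.

End Placement.

(** * Subtrees of a rooted tree and their placements *)

Section Rooted.
Variables (V : finType) (e : rel V) (x : V) (par : V -> V) (rk : V -> nat).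
Hypothesis sym_e : symmetric e.
Hypothesis parx : par x = x.
Hypothesis rk_par : forall v, v != x -> rk (par v) < rk v.
Hypothesis eE : forall a b,
  e a b = (a != x) && (par a == b) || (b != x) && (par b == a).

(** The test [c != x] keeps the root, which is its own parent, from being its own child. *)
Definition kids v := [seq c <- enum V | (c != x) && (par c == v)].

Definition desc c : {set V} := [set w | fconnect par w c].

Lemma mem_kids v c : (c \in kids v) = (c != x) && (par c == v).
Proof. by rewrite mem_filter mem_enum andbT. Qed.

Lemma kids_uniq v : uniq (kids v).
Proof. exact/filter_uniq/enum_uniq. Qed.

Lemma kids_rk v c : c \in kids v -> rk v < rk c.
Proof. by rewrite mem_kids => /andP[cx /eqP<-]; apply: rk_par. Qed.

Lemma kids_edge v c : c \in kids v -> e v c.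
Proof. by rewrite mem_kids eE => /andP[-> ->]; rewrite orbT. Qed.

Lemma desc_refl c : c \in desc c.
Proof. by rewrite inE connect0. Qed.

Lemma desc_par c w : par w \in desc c -> w \in desc c.
Proof. by rewrite !inE; apply: connect_trans (fconnect1 _ _). Qed.

Lemma desc_x c : x \in desc c -> c = x.
Proof.
rewrite inE => /connectP[p pP ->].
by elim: p pP => //= y p IHp /andP[/eqP]; rewrite parx => <- /IHp.
Qed.

Lemma par_desc c w : w \in desc c -> w != c -> par w \in desc c /\ w != x.
Proof.
move=> wc wnc; split; last first.
  by apply: contraNneq wnc => wx; move: wc; rewrite wx => /desc_x->.
move: wc; rewrite !inE => /connectP[[|y p] /= pP lastp].
  by rewrite lastp eqxx in wnc.
by case/andP: pP => /eqP-> pP; apply/connectP; exists p.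
Qed.

Lemma rank_ind (P : V -> Prop) :
  (forall v, (v != x -> P (par v)) -> P v) -> forall v, P v.
Proof.
move=> IH v; have [n] := ubnP (rk v); elim: n v => // n IHn v ltn.
by apply: IH => vx; apply: IHn; apply: leq_trans (rk_par vx) _.
Qed.

Lemma desc_rk c w : w \in desc c -> rk c <= rk w.
Proof.
elim/rank_ind: w => w IHw wc; have [->//|wnc] := eqVneq w c.
have [pc wx] := par_desc wc wnc.
exact: leq_trans (IHw wx pc) (ltnW (rk_par wx)).
Qed.

Lemma desc_root w : w \in desc x.
Proof.
elim/rank_ind: w => w IHw; have [->|wx] := eqVneq w x; first exact: desc_refl.
exact: desc_par (IHw wx).
Qed.

Lemma desc_kid v w : w \in desc v -> w != v -> exists2 c, c \in kids v & w \in desc c.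
Proof.
elim/rank_ind: w => w IHw wv wnv; have [pv wx] := par_desc wv wnv.
have [pw|pnv] := eqVneq (par w) v.
  by exists w; rewrite ?desc_refl // mem_kids wx pw eqxx.
by have [c ck pc] := IHw wx pv pnv; exists c => //; apply: desc_par.
Qed.

Lemma kid_desc v c w : c \in kids v -> w \in desc c -> w \in desc v.
Proof.
rewrite mem_kids !inE => /andP[_ /eqP<-] wc.
exact: connect_trans wc (fconnect1 _ _).
Qed.

(** Climbing from the common descendant [w], whichever of [c] and [d] is met first lies below the
    other. *)
Lemma desc_nested c d w : w \in desc c -> w \in desc d ->
  c \in desc d \/ d \in desc c.
Proof.
elim/rank_ind: w => w IHw wc wd.
have [<-|wnc] := eqVneq w c; first by left.
have [<-|wnd] := eqVneq w d; first by right.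
have [pc wx] := par_desc wc wnc; have [pd _] := par_desc wd wnd.
exact: IHw.
Qed.

(** Otherwise one sibling would lie below the other, and so would their parent [v], whose rank is
    too small. *)
Lemma kids_disjoint v c d w : c \in kids v -> d \in kids v ->
  w \in desc c -> w \in desc d -> c = d.
Proof.
move=> ck dk wc wd; apply/eqP/idPn => ncd.
have aux a b : a \in kids v -> b \in kids v -> a != b -> a \in desc b -> False.
  move=> ak bk nab /par_desc/(_ nab)[]; move: (ak); rewrite mem_kids => /andP[_ /eqP->].
  by move=> /desc_rk + _; rewrite leqNgt kids_rk.
case: (desc_nested wc wd); apply: aux => //; by rewrite eq_sym.
Qed.

Lemma desc_edge c a b : a \notin desc c -> b \in desc c -> e a b ->
  b = c /\ a = par c.
Proof.
move=> ac bc; rewrite eE => /orP[/andP[_ /eqP pa]|/andP[_ /eqP pb]].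
  by case/negP: ac; apply: desc_par; rewrite pa.
have [bc'|bnc] := eqVneq b c; first by rewrite -bc' pb.
by case/negP: ac; rewrite -pb; have [] := par_desc bc bnc.
Qed.

Definition descs (K : seq V) : {set V} := [set w | has (fun c => w \in desc c) K].

Lemma descsP (K : seq V) w : reflect (exists2 c, c \in K & w \in desc c) (w \in descs K).
Proof. by rewrite inE; apply: hasP. Qed.

(* The subtrees hanging from the children [K] of [v] can be placed on their own,
   whatever happens to [v], as long as [v] moves to distance at most [4]. *)
Definition placeable v (K : seq V) := exists f,
  placement e x (descs K) f /\ {in K, forall c, within e 2 v (f c)}.

Lemma placeable_eq v K K' : K =i K' -> placeable v K -> placeable v K'.
Proof.
move=> eqK [f [pf wf]]; exists f; split; last by move=> c; rewrite -eqK => /wf.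
suff <- : descs K = descs K' by [].
by apply/setP => w; rewrite !inE; apply: eq_has_r.
Qed.

Lemma placeable0 v : placeable v [::].
Proof.
exists id; split=> //.
by split=> [w|w|w|w w'|w]; rewrite inE.
Qed.

(** The two families of subtrees are disjoint, and an edge between them could only go from [v] to a
    member of [K'], which is the form that [placementU] asks for. *)
Lemma placeable_cat v K K' : {subset K ++ K' <= kids v} -> uniq (K ++ K') ->
  placeable v K -> placeable v K' -> placeable v (K ++ K').
Proof.
move=> subK; rewrite cat_uniq => /and3P[_ /hasPn dK _] [f [pf wf]] [g [pg wg]].
have KK c d w : c \in K -> d \in K' -> w \in desc c -> w \in desc d -> False.
  move=> cK dK' wc wd; have eq_cd : c = d.
    by apply: kids_disjoint wc wd; apply: subK; rewrite mem_cat ?cK ?dK' ?orbT.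
  by case/negP: (dK d dK'); rewrite -eq_cd.
have [|a b|h [ph hf hg]] := @placementU _ _ _ sym_e _ _ _ _ v pf pg.
- rewrite disjoints_subset; apply/subsetP => w /descsP[c cK wc].
  by rewrite inE; apply/descsP => -[d dK' wd]; apply: (KK c d w).
- move=> /descsP[c cK ac] /descsP[d dK' bd] eab.
  have and_ : a \notin desc d by apply/negP => /(KK c d a cK dK' ac).
  have [-> ->] := desc_edge and_ bd eab.
  have:= subK d; rewrite mem_cat dK' orbT mem_kids => /(_ isT)/andP[_ /eqP->].
  by split=> //; apply: wg.
exists h; split.
  suff -> : descs (K ++ K') = descs K :|: descs K' by [].
  by apply/setP => w; rewrite !inE has_cat.
move=> c; rewrite mem_cat => /orP[cK|cK].
  by rewrite hf ?wf //; apply/descsP; exists c; rewrite ?desc_refl.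
by rewrite hg ?wg //; apply/descsP; exists c; rewrite ?desc_refl.
Qed.

(* The roots of the components of [A] have parents ranked below all of [A]: this
   holds when they are siblings, and also when [A] has the single root [x]. *)
Definition top_closed (A : {set V}) :=
  {in A, forall a, par a \in A \/ {in A, forall w, rk (par a) <= rk w}}.

(** Climbing from [a] inside [A] never meets [c], which is outside [A]. So it would stop at a root
    of [A] whose parent is still below [c], hence ranked above [w], against [top_closed]. *)
Lemma top_closed_desc (A : {set V}) w c a : top_closed A -> w \in A ->
  c \in kids w -> c \notin A -> a \in A -> a \notin desc c.
Proof.
move=> clA wA cw cA; elim/rank_ind: a => a IHa aA; apply/negP => ac.
have anc : a != c by apply: contraNneq cA => <-.
have [pc ax] := par_desc ac anc.
have [pA|/(_ w wA) le_pw] := clA a aA; first by case/negP: (IHa ax pA).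
by have:= leq_trans (desc_rk pc) le_pw; rewrite leqNgt kids_rk.
Qed.

(** The missing subtrees are added in batches, one for each vertex of [A], since [placementU] glues
    along edges starting at a single vertex. *)
Lemma placement_attach (A : {set V}) f : top_closed A -> placement e x A f ->
    {in A, forall w, placeable w [seq c <- kids w | c \notin A]} ->
  exists h, placement e x (descs (enum A)) h /\ {in A, h =1 f}.
Proof.
move=> clA pf pK; pose K w := [seq c <- kids w | c \notin A].
have KP w c : c \in K w -> c \notin A /\ c \in kids w.
  by rewrite mem_filter => /andP.
have memK w c : c \in K w -> c \in descs (K w).
  by move=> cK; apply/descsP; exists c; rewrite ?desc_refl.
pose B s := A :|: \bigcup_(w <- s) descs (K w).
suff grow (s : seq V) : uniq s -> {subset s <= A} ->
    exists h, placement e x (B s) h /\ {in A, h =1 f}.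
  have [||h [ph hf]] := grow (enum A); first exact: enum_uniq.
    by move=> w; rewrite mem_enum.
  exists h; split=> //; suff -> : descs (enum A) = B (enum A) by [].
  apply/eqP; rewrite eqEsubset; apply/andP; split; apply/subsetP => w.
    case/descsP=> a; rewrite mem_enum.
    (* From an ancestor [a] of [w] in [A], descend towards [w] until [w] is reached or the next
       child is outside [A]. *)
    have [n] := ubnP (rk w - rk a); elim: n a => // n IHn a ltn aA wa.
    have [->|wna] := eqVneq w a; first by rewrite inE aA.
    have [c ck wc] := desc_kid wa wna.
    have [cA|cA] := boolP (c \in A).
      by apply: (IHn c) => //; have := kids_rk ck; have := desc_rk wc; lia.
    rewrite inE; apply/orP; right; rewrite bigcup_seq.
    apply/bigcupP; exists a; rewrite ?mem_enum //.
    by apply/descsP; exists c => //; rewrite mem_filter cA ck.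
  rewrite inE => /orP[wA|].
    by apply/descsP; exists w; rewrite ?mem_enum ?desc_refl.
  rewrite bigcup_seq => /bigcupP[a]; rewrite mem_enum => aA /descsP[c cK wc].
  have [_ ck] := KP _ _ cK; by apply/descsP; exists a; rewrite ?mem_enum //; apply: kid_desc wc.
elim: s => [|w s IHs] /=.
  by move=> _ _; exists f; rewrite /B big_nil setU0.
case/andP=> ws us sA; have wA : w \in A by apply: sA; rewrite mem_head.
have [|h [ph hf]] := IHs us; first by move=> u us'; apply: sA; rewrite inE us' orbT.
have [g [pg wg]] := pK w wA.
(* The new batch is disjoint from the earlier ones: nested subtrees from two batches would put a
   vertex of [A] below a child outside [A]. *)
have BK u c : c \in K w -> u \in B s -> u \notin desc c.
  move=> cK; have [cA ck] := KP _ _ cK; rewrite inE => /orP[uA|].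
    exact: (top_closed_desc clA wA ck cA uA).
  rewrite bigcup_seq => /bigcupP[v vs /descsP[d dK ud]].
  have [dA dk] := KP _ _ dK; have vA : v \in A by apply: sA; rewrite inE vs orbT.
  have ncd : c != d.
    apply: contraNneq ws => cd; move: ck dk; rewrite !mem_kids cd.
    by move=> /andP[_ /eqP<-] /andP[_ /eqP->].
  apply/negP => uc; case: (desc_nested uc ud).
    move/par_desc=> /(_ ncd)[pcd _]; have:= top_closed_desc clA vA dk dA wA.
    by move: ck; rewrite mem_kids => /andP[_ /eqP<-]; rewrite pcd.
  move/par_desc; rewrite eq_sym => /(_ ncd)[pcd _].
  have:= top_closed_desc clA wA ck cA vA.
  by move: dk; rewrite mem_kids => /andP[_ /eqP<-]; rewrite pcd.
have [|a b|h' [ph' hh' _]] := @placementU _ _ _ sym_e _ _ _ _ w ph pg.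
- rewrite disjoints_subset; apply/subsetP => u uB; rewrite inE.
  by apply/descsP => -[c cK uc]; case/negP: (BK u c cK uB).
- move=> aB /descsP[c cK bc] eab.
  have [-> ->] := desc_edge (BK a c cK aB) bc eab.
  have [_] := KP _ _ cK; rewrite mem_kids => /andP[_ /eqP->].
  by split=> //; apply: wg.
exists h'; split; first by rewrite /B big_cons setUA setUAC.
by move=> u uA; rewrite hh' ?hf // inE uA.
Qed.

(* The vertex [v] has type [k] when only its children in [K] are considered. *)
Fixpoint leg k v (K : seq V) : Prop :=
  if k is k'.+1 then
    exists2 c, c \in K & placeable v (rem c K) /\ leg k' c (kids c)
  else placeable v K.

End Rooted.

(** * Combs *)

(* A comb has spine vertices [(i, 0)], [i < size a], at mutual distances [dl i k];
   the leg [(i, 1), ..., (i, nth 0 a i)] is a path hanging from [(i, 0)]. Two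
   vertices are adjacent iff their distance is 1. *)
Definition comb_dist (dl : nat -> nat -> nat) (p q : nat * nat) :=
  if p.1 == q.1 then (p.2 - q.2) + (q.2 - p.2) else p.2 + dl p.1 q.1 + q.2.

Definition comb_verts (a : seq nat) :=
  [seq (i, j) | i <- iota 0 (size a), j <- iota 0 (nth 0 a i).+1].

(* The list [t] describes the map sending the [k]-th vertex of [comb_verts a] to
   its [nth 0 t k]-th vertex. *)
Definition comb_map (a t : seq nat) (p : nat * nat) :=
  let vs := comb_verts a in nth p vs (nth 0 t (index p vs)).

(** A decidable counterpart of [placement] for an abstract comb; [m] carries the displacement
    bounds, which depend on where [x] may be. *)
Definition comb_ok dl (m : rel (nat * nat)) (a t : seq nat) :=
  let vs := comb_verts a in let g := comb_map a t in
  all (fun p => [&& g p \in vs, g p != p,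
      has (fun k => iter k g p == p) (iota 1 5), m p (g p)
    & all (fun q => (comb_dist dl p q == 1) ==>
        (1 < comb_dist dl (g p) (g q) <= 6)) vs]) vs.

Lemma mem_comb a i j :
  ((i, j) \in comb_verts a) = (i < size a) && (j <= nth 0 a i).
Proof.
apply/allpairsPdep/andP => [[k [l [+ + [-> ->]]]]|[ia ja]].
  by rewrite !mem_iota !add0n.
by exists i, j; rewrite !mem_iota.
Qed.

(** Choice by induction on a finite list; [t0] only fills in the values off the list. *)
Lemma seq_choice (T T' : eqType) (t0 : T') (s : seq T) (Q : T -> T' -> Prop) :
  {in s, forall a, exists b, Q a b} -> exists F, {in s, forall a, Q a (F a)}.
Proof.
elim: s => [|a s IHs] ex; first by exists (fun=> t0).
have [|F FP] := IHs; first by move=> b bs; apply: ex; rewrite inE bs orbT.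
have [b Qab] := ex a (mem_head _ _).
exists (fun c => if c == a then b else F c) => c.
by rewrite inE; case: eqVneq => [->|_] //= /FP.
Qed.

(** * Realizing a comb in the tree *)

Section Core.
Variables (V : finType) (e : rel V) (x : V) (par : V -> V) (rk : V -> nat).
Hypothesis sym_e : symmetric e.
Hypothesis parx : par x = x.
Hypothesis rk_par : forall v, v != x -> rk (par v) < rk v.
Hypothesis eE : forall a b,
  e a b = (a != x) && (par a == b) || (b != x) && (par b == a).
Notation kids := (kids x par).
Notation desc := (desc par).
Notation descs := (descs par).
Notation placeable := (placeable e x par).
Notation leg := (leg e x par).

(** Unfolding [leg] collects the child removed at each level. The whole chain lies below the first
    one, [c], so deleting it from [K] removes only [c]. *)
Lemma leg_chain k v (K : seq V) : uniq K -> {subset K <= kids v} -> leg k v K ->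
  exists p, [/\ size p = k, path (fun a b => b \in kids a) v p,
    {subset p <= descs K}
  & {in v :: p, forall w,
      placeable w [seq c <- if w == v then K else kids w | c \notin p]}].
Proof.
elim: k v K => [|k IHk] v K uK Kv /=.
  move=> pK; exists [::]; split=> // w; rewrite inE => /eqP->.
  by rewrite eqxx filter_predT.
case=> c cK [pK /IHk]; rewrite kids_uniq => -[] // p [sz pP pc pl].
have rk_c w : w \in c :: p -> w \in desc c.
  rewrite inE => /predU1P[->|/pc/descsP[d dk wd]]; first exact: desc_refl.
  exact: kid_desc dk wd.
have p_rk w : w \in p -> rk c < rk w.
  case/pc/descsP=> d dk wd.
  exact: leq_trans (kids_rk rk_par dk) (desc_rk parx rk_par wd).
have vc := kids_rk rk_par (Kv c cK).
exists (c :: p); split; rewrite /= ?sz ?Kv //.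
- by move=> w /rk_c wc; apply/descsP; exists c.
move=> w; rewrite inE => /predU1P[->|wp].
  rewrite eqxx; apply: placeable_eq pK => d.
  rewrite mem_filter (mem_rem_uniq _ uK) !inE negb_or -andbA.
  have [//|dc] := eqVneq d c; rewrite !andTb; have [dK|] := boolP (d \in K); last by rewrite andbF.
  rewrite andbT; symmetry; apply/negP => dp.
  have dc' : d \in desc c by apply: rk_c; rewrite inE dp orbT.
  case/eqP: dc; exact: (kids_disjoint parx rk_par (Kv d dK) (Kv c cK) (desc_refl _ d)).
have lt_cw := desc_rk parx rk_par (rk_c w wp).
have /negPf-> : w != v by apply: contraTneq lt_cw => ->; rewrite -ltnNge.
apply: placeable_eq (pl w wp) => d.
have -> : (if w == c then kids c else kids w) = kids w by case: eqVneq => [->|].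
rewrite mem_filter [RHS]mem_filter.
have [dw|] := boolP (d \in kids w); last by rewrite !andbF.
rewrite inE negb_or; suff -> : d != c by [].
by apply: contraTneq (kids_rk rk_par dw) => ->; rewrite -leqNgt.
Qed.

(* The list [S] is a spine whose vertices have types [l]; the comb formed by [S] and
   the chains of children witnessing these types is placed according to [t]. *)
Lemma core_placement (S : seq V) (l : V -> nat) dl m t (a := map l S) :
    uniq S -> top_closed par rk [set v in S] ->
    (forall i k, i < size S -> k < size S -> i != k ->
      [/\ 0 < dl i k, e (nth x S i) (nth x S k) = (dl i k == 1)
        & within e (dl i k) (nth x S i) (nth x S k)]) ->
    {in S, forall v, leg (l v) v [seq c <- kids v | c \notin S]} ->
    comb_ok dl m a t ->
    (forall i q w, i < size S -> q.1 < size S -> m (i, 0) q ->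
      within e q.2 (nth x S q.1) w -> moves_ok e x (nth x S i) w) ->
    (forall i j q, i < size S -> q.1 < size S -> m (i, j.+1) q ->
      comb_dist dl (i, j.+1) q <= 4 /\
      (nth x S i = x -> j = 0 -> comb_dist dl (i, j.+1) q <= 3)) ->
  exists h, placement e x (descs S) h /\
    forall i, i < size S -> exists q, [/\ q.1 < size S, m (i, 0) q
      & within e q.2 (nth x S q.1) (h (nth x S i))].
Proof.
move=> uS clS dlP legS ok mS mL.
pose KS v := [seq c <- kids v | c \notin S].
have KSP v c : c \in KS v -> c \notin S /\ c \in kids v.
  by rewrite mem_filter => /andP.
pose Q v p := [/\ size p = l v, path (fun a b => b \in kids a) v p,
    {subset p <= descs (KS v)}
  & {in v :: p, forall w,
      placeable w [seq c <- if w == v then KS v else kids w | c \notin p]}].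
have [P PP] : exists P, {in S, forall v, Q v (P v)}.
  apply: (seq_choice [::]) => v vS; apply: leg_chain (legS v vS).
    exact/filter_uniq/kids_uniq.
  by move=> c; rewrite mem_filter => /andP[].
have descP v w : v \in S -> w \in P v ->
    exists c, [/\ c \notin S, c \in kids v & w \in desc c].
  move=> vS wP; have [_ _ /(_ w wP)/descsP[c cK wc] _] := PP v vS.
  by have [cS ck] := KSP v c cK; exists c.
have SN v c u : v \in S -> c \in kids v -> c \notin S -> u \in S -> u \notin desc c.
  move=> vS cv cS uS'.
  by apply: (top_closed_desc parx rk_par clS _ cv); rewrite inE.
have PS v w : v \in S -> w \in P v -> w \notin S.
  move=> vS /(descP v w vS)[c [cS ck wc]]; apply/negP => wS.
  by case/negP: (SN v c w vS ck cS wS).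
have P_desc v w : v \in S -> w \in v :: P v -> w \in desc v.
  move=> vS; rewrite inE => /predU1P[->|/(descP v w vS)[c [_ ck wc]]].
    exact: desc_refl.
  exact: kid_desc ck wc.
have P_rk v w : v \in S -> w \in P v -> rk v < rk w.
  move=> vS /(descP v w vS)[c [_ ck wc]].
  exact: leq_trans (kids_rk rk_par ck) (desc_rk parx rk_par wc).
(* Different legs are disjoint: if the children [c] and [d] where they start were nested, a spine
   vertex would lie below a child outside the spine. *)
have P_inj v v' w : v \in S -> v' \in S -> w \in v :: P v -> w \in v' :: P v' -> v = v'.
  move=> vS vS'; rewrite !inE => /predU1P[->|wP] /predU1P[wv|wP'] //.
  - by case/negP: (PS v' v vS' wP').
  - by case/negP: (PS v w vS wP); rewrite wv.
  have [c [cS ck wc]] := descP v w vS wP.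
  have [d [dS dk wd]] := descP v' w vS' wP'.
  apply/eqP/idPn => nvv; have ncd : c != d.
    apply: contraNneq nvv => cd; move: ck dk; rewrite cd !mem_kids.
    by move=> /andP[_ /eqP<-] /andP[_ /eqP<-].
  case: (desc_nested parx rk_par wc wd) => [cd|dc].
    have [pcd _] := par_desc parx cd ncd.
    move: ck; rewrite mem_kids => /andP[_ /eqP pc].
    by case/negP: (SN v' d v vS' dk dS vS); rewrite -pc.
  rewrite eq_sym in ncd; have [pcd _] := par_desc parx dc ncd.
  move: dk; rewrite mem_kids => /andP[_ /eqP pd].
  by case/negP: (SN v c v' vS ck cS vS'); rewrite -pd.
pose vs := comb_verts a; pose ch i := nth x S i :: P (nth x S i).
(* [phi] embeds the abstract comb in the tree, coordinate [j = 0] giving the spine vertex itself. *)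
pose phi (p : nat * nat) := nth x (ch p.1) p.2.
have chS i : i < size S -> nth x S i \in S by move=> /(mem_nth x).
have vsE i j : ((i, j) \in vs) = (i < size S) && (j < size (ch i)).
  rewrite mem_comb size_map; have [iS|//] := ltnP i (size S).
  by rewrite (nth_map x) //= ltnS; have [-> _ _ _] := PP _ (chS i iS).
have phi_ch i j : (i, j) \in vs -> phi (i, j) \in ch i.
  by rewrite vsE => /andP[_ jc]; apply: mem_nth.
have ch_uniq i : i < size S -> uniq (ch i).
  move=> iS; have [_ pP _ _] := PP _ (chS i iS).
  have tr : transitive [rel u w | rk u < rk w] by move=> u v w /=; apply: ltn_trans.
  have ir : irreflexive [rel u w | rk u < rk w] by move=> u /=; rewrite ltnn.
  apply: (sorted_uniq tr ir); apply: sub_path pP => u w /=; exact: kids_rk.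
have phi_inj : {in vs &, injective phi}.
  move=> [i j] [k n] pv qv eq_phi.
  move: (pv) (qv); rewrite !vsE => /andP[iS jc] /andP[kS nc].
  have eq_ik : i = k.
    apply/eqP; rewrite -(nth_uniq x iS kS uS); apply/eqP.
    apply: (@P_inj _ _ (phi (i, j))); rewrite ?chS ?phi_ch //.
    by rewrite eq_phi; apply: phi_ch.
  subst k; congr (_, _); apply/eqP; rewrite -(nth_uniq x jc nc (ch_uniq i iS)).
  exact/eqP.
have phi_kid i j : (i, j.+1) \in vs -> phi (i, j.+1) \in kids (phi (i, j)).
  rewrite vsE => /andP[iS jc]; have [_ pP _ _] := PP _ (chS i iS).
  exact: (pathP x pP).
have phi_par i j : (i, j.+1) \in vs -> (phi (i, j.+1) != x) * (par (phi (i, j.+1)) = phi (i, j)).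
  by move/phi_kid; rewrite mem_kids => /andP[-> /eqP].
have vs_down i j : (i, j.+1) \in vs -> (i, j) \in vs.
  by rewrite !vsE => /andP[-> /ltnW].
have phiS i j : (i, j.+1) \in vs -> phi (i, j.+1) \in P (nth x S i).
  by rewrite vsE => /andP[iS jc]; rewrite /phi /=; apply: mem_nth.
(* By [top_closed], the parent of a spine vertex is on the spine or ranks no higher than any spine
   vertex, whereas leg vertices rank above the spine vertex they hang from. *)
have par_spine i k n : i < size S -> (k, n.+1) \in vs ->
    (par (phi (i, 0)) == phi (k, n.+1)) = false.
  move=> iS qv; have kS : k < size S by move: qv; rewrite vsE => /andP[].
  have qP := phiS k n qv; apply/eqP => pe.
  have [|pS|le_p] := clS (nth x S i); first by rewrite inE chS.
    by case/negP: (PS _ _ (chS k kS) qP); rewrite -pe; rewrite inE in pS.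
  have := le_p (nth x S k); rewrite inE chS // pe => /(_ isT).
  by rewrite leqNgt P_rk ?chS.
have phi0 i : phi (i, 0) = nth x S i by [].
have phiE i j : phi (i, j) = nth x (ch i) j by [].
clearbody phi.
have e_phi p q : p \in vs -> q \in vs -> e (phi p) (phi q) = (comb_dist dl p q == 1).
  case: p q => [i j] [k n] pv qv.
  have /andP[iS _] : (i < size S) && (j < size (ch i)) by rewrite -vsE.
  have /andP[kS _] : (k < size S) && (n < size (ch k)) by rewrite -vsE.
  have phi_eq p q : p \in vs -> q \in vs -> (phi p == phi q) = (p == q).
    move=> pvs qvs; apply/eqP/eqP => [|-> //]; exact: phi_inj.
  rewrite /comb_dist /=; case: j n pv qv => [|j] [|n] pv qv.
  - have [->|nik] := eqVneq i k; last first.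
      by rewrite !phi0; have [_ ->] := dlP i k iS kS nik; rewrite addn0.
    rewrite subnn eE orbb; apply/negP => /andP[vx /eqP pv'].
    by have:= rk_par vx; rewrite pv' ltnn.
  - rewrite eE (par_spine i k n iS qv) andbF /= !(phi_par k n qv).
    rewrite (phi_eq (k, n) (i, 0) (vs_down k n qv) pv) /=.
    rewrite xpair_eqE; have [_ /=|nik] := eqVneq i k; first by rewrite sub0n subn0; lia.
    by have [dl0 _ _] := dlP i k iS kS nik; lia.
  - rewrite eE (par_spine k i j kS pv) andbF orbF !(phi_par i j pv).
    rewrite (phi_eq (i, j) (k, 0) (vs_down i j pv) qv) /=.
    rewrite xpair_eqE; have [_ /=|nik] := eqVneq i k; first by rewrite sub0n subn0; lia.
    by have [dl0 _ _] := dlP i k iS kS nik; lia.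
  - rewrite eE !(phi_par i j pv) !(phi_par k n qv) /=.
    rewrite (phi_eq (i, j) (k, n.+1) (vs_down i j pv) qv).
    rewrite (phi_eq (k, n) (i, j.+1) (vs_down k n qv) pv) !xpair_eqE.
    by have [_ /=|nik] := eqVneq i k; lia.
have w_leg i j n : (i, j + n) \in vs -> within e n (phi (i, j)) (phi (i, j + n)).
  elim: n => [|n IHn]; first by rewrite addn0 within_refl.
  rewrite addnS => pv; rewrite -addn1.
  apply: within_trans (IHn (vs_down _ _ pv)) _; apply: within1.
  exact/(kids_edge eE)/phi_kid.
(* Only distance 1 has to be exact, as in [e_phi]; elsewhere the upper bound given by a walk along
   the comb is enough. *)
have w_phi p q : p \in vs -> q \in vs -> within e (comb_dist dl p q) (phi p) (phi q).
  case: p q => [i j] [k n] pv qv.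
  have /andP[iS _] : (i < size S) && (j < size (ch i)) by rewrite -vsE.
  have /andP[kS _] : (k < size S) && (n < size (ch k)) by rewrite -vsE.
  rewrite /comb_dist /=; have [ik|nik] := eqVneq i k.
    subst k; have [le_jn|/ltnW le_nj] := leqP j n.
      have:= w_leg i j (n - j); rewrite subnKC // => /(_ qv).
      by move: le_jn; rewrite -subn_eq0 => /eqP->.
    rewrite within_sym //; have:= w_leg i n (j - n); rewrite subnKC // => /(_ pv).
    by move: le_nj; rewrite -subn_eq0 => /eqP->; rewrite addn0.
  have [_ _ wd] := dlP i k iS kS nik; rewrite -!phi0 in wd.
  apply: within_trans (w_leg k 0 n qv); apply: within_trans wd.
  by rewrite within_sym //; apply: (w_leg i 0 j).
(* [psi] inverts [phi] on the comb and takes the value [(0, 0)] elsewhere; it transports [g] to the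
   tree. *)
pose g := comb_map a t; pose psi v := nth (0, 0) vs (index v (map phi vs)).
have psiK p : p \in vs -> psi (phi p) = p by move=> pv; apply: nth_index_map.
have gP p : p \in vs -> [/\ g p \in vs, g p != p,
    exists2 k, 0 < k <= 5 & iter k g p = p, m p (g p) &
    {in vs, forall q, comb_dist dl p q == 1 -> 1 < comb_dist dl (g p) (g q) <= 6}].
  move=> pv; have /and5P[g1 g2 /hasP[k k5 /eqP gk] g4 /allP g5] := allP ok p pv.
  split=> //; first by exists k => //; move: k5; rewrite mem_iota.
  by move=> q /g5/implyP.
pose f v := phi (g (psi v)).
have fE p : p \in vs -> f (phi p) = phi (g p) by move=> pv; rewrite /f psiK.
pose A := [set w in map phi vs].
have AP w : reflect (exists2 p, p \in vs & w = phi p) (w \in A).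
  by rewrite inE; apply: mapP.
have phiA p : p \in vs -> phi p \in A by move=> pv; apply/AP; exists p.
have S_vs i : i < size S -> (i, 0) \in vs by move=> iS; rewrite vsE iS.
have pf : placement e x A f.
  split=> [w /AP[p pv ->]|w /AP[p pv ->]|w /AP[p pv ->]
    |u w /AP[p pv ->] /AP[q qv ->]|w /AP[p pv ->]].
  - by rewrite fE // phiA //; have [] := gP p pv.
  - have [gpv gpN _ _ _] := gP p pv; rewrite fE //; apply: contra gpN => /eqP/phi_inj-> //.
  - have [_ _ [k k5 gk] _ _] := gP p pv; exists k => //.
    suff : iter k f (phi p) = phi (iter k g p) /\ iter k g p \in vs by rewrite gk => -[].
    elim: k {k5 gk} => //= k [-> kv]; rewrite fE //; split=> //.
    by have [] := gP _ kv.
  - rewrite e_phi // !fE // => /eqP d1.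
    have [gpv _ _ _ gE] := gP p pv; have [gqv _ _ _ _] := gP q qv.
    have /andP[d_gt d_le] := gE q qv (introT eqP d1); rewrite e_phi //.
    by split; [rewrite neq_ltn d_gt orbT|apply: within_leq d_le (w_phi _ _ gpv gqv)].
  rewrite fE //; have [gpv _ _ mp _] := gP p pv.
  case: p pv gpv mp => [i [|j]] pv gpv mp; case gp: (g _) gpv mp => [k n] gpv mp.
    have /andP[iS _] : (i < size S) && (0 < size (ch i)) by rewrite -vsE.
    have /andP[kS _] : (k < size S) && (n < size (ch k)) by rewrite -vsE.
    by rewrite phi0; apply: (mS i (k, n)) => //=; rewrite -phi0; apply: (w_leg k 0 n).
  have /andP[iS _] : (i < size S) && (j.+1 < size (ch i)) by rewrite -vsE.
  have /andP[kS _] : (k < size S) && (n < size (ch k)) by rewrite -vsE.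
  have [d4 d3] := mL i j (k, n) iS kS mp; have wd := w_phi _ _ pv gpv.
  have [px pp] := phi_par i j pv.
  (* A leg vertex adjacent to [x] is a child of [x]. Since no leg vertex is the root, that parent is
     on the spine, so [j = 0] and the bound 3 is available. *)
  have exE : e x (phi (i, j.+1)) -> phi (i, j) = x.
    by rewrite eE eqxx px pp /= => /eqP.
  split; first exact: within_leq wd.
    move/exE=> pjx; have j0 : j = 0.
      case: j pv pjx {mp d4 d3 px pp exE gp wd} => // j pv pjx.
      by have [] := phi_par i j (vs_down _ _ pv); rewrite pjx eqxx.
    by apply: within_leq wd; apply: d3 => //; rewrite -phi0 -[0]j0.
  by move=> pe; rewrite pe eqxx in px.
have S_sub w : w \in S -> w \in A.
  by move=> wS; rewrite -(nth_index x wS) -phi0;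
    apply: (phiA (index w S, 0)); rewrite S_vs ?index_mem.
have A_ch w : w \in A -> exists2 v, v \in S & w \in v :: P v.
  case/AP=> [[i j] pv ->]; exists (nth x S i); last exact: phi_ch.
  by move: pv; rewrite vsE => /andP[/chS].
have ch_A v w : v \in S -> w \in v :: P v -> w \in A.
  move=> vS wv; apply/AP; exists (index v S, index w (v :: P v)).
    by rewrite vsE /ch index_mem vS nth_index // index_mem.
  by rewrite phiE /ch nth_index // nth_index.
have clA : top_closed par rk A.
  move=> w /AP[[i [|j]] pv ->]; last first.
    by left; have [_ ->] := phi_par i j pv; apply/phiA/vs_down.
  have iS : i < size S by move: pv; rewrite vsE => /andP[].
  have [|pS|pS] := clS (nth x S i); first by rewrite inE chS.
    by left; apply: S_sub; rewrite inE phi0 in pS *.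
  right=> u /A_ch[v vS uv]; rewrite phi0; apply: leq_trans (pS v _) _; first by rewrite inE.
  exact: (desc_rk parx rk_par (P_desc v u vS uv)).
(* These are the children that [leg_chain] left placeable, because a child of [w] that lies on any
   leg lies on the leg of [w] itself. *)
have plA : {in A, forall w, placeable w [seq c <- kids w | c \notin A]}.
  move=> w /A_ch[v vS wv]; have [_ pP _ /(_ w wv)] := PP v vS.
  apply: placeable_eq => c; rewrite mem_filter [RHS]mem_filter.
  have kid_in u : u \in S -> c \in kids w -> c \in P u -> u = v.
    move=> uS' cw cP; apply: (P_inj _ _ w) => //.
    have /AP[[i j] pv ce] : c \in A by apply: (ch_A u); rewrite // inE cP orbT.
    have cu : c \in ch i by rewrite ce; apply: phi_ch.
    have iS : i < size S by move: pv; rewrite vsE => /andP[].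
    have <- : nth x S i = u by apply: (P_inj _ _ c); rewrite ?chS // inE cP orbT.
    case: j pv ce => [|j] pv ce.
      by case/negP: (PS u c uS' cP); rewrite ce phi0 chS.
    move: cw; rewrite mem_kids ce => /andP[_]; have [_ ->] := phi_par i j pv.
    by move/eqP<-; apply/phi_ch/vs_down.
  have -> : (c \in (if w == v then KS v else kids w)) = (c \in kids w) && (c \notin S).
    case: eqVneq => [->|nwv]; first by rewrite mem_filter andbC.
    have [cw|//] := boolP (c \in kids w); symmetry; apply/negP => cS.
    move: wv; rewrite inE (negPf nwv) /= => wP.
    have /AP[[i j] pv we] : w \in A by apply: (ch_A v); rewrite // inE wP orbT.
    case: j pv we => [|j] pv we.
      by case/negP: (PS v w vS wP); rewrite we phi0 chS //; move: pv; rewrite vsE => /andP[].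
    have := par_spine (index c S) i j; rewrite index_mem phi0 nth_index // -we => /(_ cS pv).
    by move: cw; rewrite mem_kids => /andP[_ ->].
  have [cw|] := boolP (c \in kids w); last by rewrite !andbF.
  rewrite andbT /=; apply/andP/idP => [[cP cS]|cA].
    apply/negP => /A_ch[u uS']; rewrite inE => /predU1P[cu|cP'].
      by rewrite cu uS' in cS.
    by rewrite -(kid_in u uS' cw cP') cP' in cP.
  split; apply: contra cA; last exact: S_sub.
  by move=> cP; apply: (ch_A v); rewrite // inE cP orbT.
have [h [ph hf]] := placement_attach sym_e parx rk_par eE clA pf plA.
exists h; split.
  suff <- : descs (enum A) = descs S by [].
  apply/setP => w; apply/descsP/descsP => -[c]; last first.
    by move=> cS wc; exists c; rewrite ?mem_enum ?S_sub.
  rewrite mem_enum => /A_ch[v vS cv] wc; exists v => //.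
  by move: (P_desc v c vS cv) wc; rewrite !inE => ? ?; apply: connect_trans; eauto.
move=> i iS; have pv := S_vs i iS; have [gpv _ _ mp _] := gP _ pv.
exists (g (i, 0)); case gp: (g _) gpv mp => [k n] gpv mp.
have /andP[kS _] : (k < size S) && (n < size (ch k)) by rewrite -vsE.
split=> //=; rewrite -!phi0 hf ?phiA // fE // gp.
exact: (w_leg k 0 n).
Qed.

End Core.

(** * Placements of small combs *)

Fixpoint words b n : seq (seq nat) :=
  if n is n'.+1 then [seq i :: w | i <- iota 0 b, w <- words b n'] else [:: [::]].

Lemma mem_words b n w : size w = n -> all (gtn b) w -> w \in words b n.
Proof.
elim: n w => [|n IHn] [|i w] //= [sz] /andP[ib wb].
by apply/allpairsP; exists (i, w); rewrite mem_iota IHn.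
Qed.

Lemma all2_mem (T T' : eqType) (r : T -> T' -> bool) s t a :
  all2 r s t -> a \in s -> exists b, r a b.
Proof.
elim: s t => [|c s IHs] [|d t] //= /andP[rcd /IHs ex].
by rewrite inE => /predU1P[->|/ex//]; exists d.
Qed.

(* Siblings are at distance 2. The second condition of [sib_move] keeps the images
   of the siblings at distance at most 2 from their parent. *)
Definition sib_dist (i k : nat) := 2.

Definition sib_move : rel (nat * nat) := fun p q =>
  (comb_dist sib_dist p q <= 4) && ((p.2 == 0) ==> (q.2 <= 1)).

(* The bounds of [path_move] are suitable both when [x] is the first and when it is
   the second vertex of the path. *)
Definition path_dist (i k : nat) := (i - k) + (k - i).

Definition path_move : rel (nat * nat) := fun p q =>
  comb_dist path_dist p q <=
    (if (p.1 <= 1) && (p.2 == 0) then 2 else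
     if (p.1 <= 1) && (p.2 == 1) || (p == (2, 0)) then 3 else 4).

(* The tables were found by a backtracking search; their entries are indexed by the
   words over the possible types of the spine vertices, in lexicographic order. *)
Definition pair_table : seq (seq nat) := [::
  [:: 1;0]; [:: 1;2;0]; [:: 2;0;3;1]; [:: 1;2;0]; [:: 1;2;3;0]; [:: 1;3;0;4;2];
  [:: 3;2;0;1]; [:: 3;2;0;4;1]; [:: 4;2;3;1;5;0]].

Definition triple_table : seq (seq nat) := [::
  [:: 1;2;0]; [:: 1;2;3;0]; [:: 1;3;0;4;2]; [:: 1;0;3;2]; [:: 1;0;3;4;2];
  [:: 1;0;4;2;5;3]; [:: 1;0;3;4;2]; [:: 1;0;3;4;5;2]; [:: 1;5;3;4;2;6;0];
  [:: 1;2;3;0]; [:: 1;2;3;4;0]; [:: 1;3;4;0;5;2]; [:: 1;2;0;4;3];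
  [:: 1;2;0;4;5;3]; [:: 1;2;0;5;3;6;4]; [:: 1;2;0;4;5;3]; [:: 1;2;0;4;5;6;3];
  [:: 1;2;6;4;5;3;7;0]; [:: 3;2;0;4;1]; [:: 3;2;4;0;5;1]; [:: 3;2;4;5;1;6;0];
  [:: 3;2;0;1;5;4]; [:: 3;2;0;1;5;6;4]; [:: 3;2;0;1;6;4;7;5];
  [:: 3;2;0;1;5;6;4]; [:: 3;2;0;1;5;6;7;4]; [:: 4;2;6;7;5;0;1;8;3]].

Definition path_table : seq (seq nat) := [::
  [:: 1;3;0;2]; [:: 1;3;0;4;2]; [:: 1;3;5;0;2;4]; [:: 1;3;5;0;2;6;4];
  [:: 1;3;0;4;2]; [:: 1;4;3;5;0;2]; [:: 1;3;4;0;6;2;5]; [:: 1;3;0;2;5;7;4;6];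
  [:: 1;3;5;0;2;4]; [:: 1;3;0;2;6;4;5]; [:: 1;3;0;2;6;4;7;5];
  [:: 1;3;0;2;6;4;8;5;7]; [:: 1;3;0;2;5;6;4]; [:: 1;3;0;2;5;6;7;4];
  [:: 1;3;0;2;5;6;8;4;7]; [:: 1;3;0;5;7;2;4;9;6;8]; [:: 1;4;0;2;3];
  [:: 2;3;0;5;1;4]; [:: 1;4;0;6;2;3;5]; [:: 1;4;0;6;2;3;7;5]; [:: 1;4;5;0;3;2];
  [:: 1;4;5;0;3;6;2]; [:: 1;4;0;5;2;7;3;6]; [:: 1;4;0;2;3;6;8;5;7];
  [:: 1;4;0;6;2;3;5]; [:: 1;4;0;2;3;7;5;6]; [:: 1;4;0;2;3;7;5;8;6];
  [:: 1;4;0;2;3;7;5;9;6;8]; [:: 1;4;0;2;3;6;7;5]; [:: 1;4;0;2;3;6;7;8;5];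
  [:: 1;4;0;2;3;6;7;9;5;8]; [:: 1;4;0;6;2;3;5;8;10;7;9]; [:: 1;3;4;0;5;2];
  [:: 1;3;0;5;6;2;4]; [:: 1;3;0;2;5;7;4;6]; [:: 1;3;0;2;5;7;4;8;6];
  [:: 1;3;4;0;5;6;2]; [:: 1;3;0;2;5;6;7;4]; [:: 1;3;0;2;5;6;8;4;7];
  [:: 1;3;0;2;5;7;8;4;9;6]; [:: 1;3;0;2;6;7;5;4]; [:: 1;3;0;2;6;7;5;8;4];
  [:: 1;3;0;2;5;8;4;9;6;7]; [:: 1;3;0;2;5;8;4;9;6;10;7];
  [:: 1;3;0;2;6;8;7;5;4]; [:: 1;3;0;2;6;8;7;4;9;5];
  [:: 1;3;0;2;5;7;9;4;10;6;8]; [:: 1;3;0;2;5;7;4;6;9;11;8;10];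
  [:: 1;3;5;4;0;6;2]; [:: 1;3;5;4;0;7;2;6]; [:: 1;3;0;4;2;6;8;5;7];
  [:: 1;3;0;4;2;6;8;5;9;7]; [:: 1;3;5;4;0;6;7;2]; [:: 1;3;0;4;2;6;7;8;5];
  [:: 1;3;0;4;2;6;7;9;5;8]; [:: 1;3;0;4;2;6;8;9;5;10;7];
  [:: 1;3;0;4;2;7;8;6;5]; [:: 1;3;0;4;2;7;8;6;9;5];
  [:: 1;3;0;4;2;6;9;5;10;7;8]; [:: 1;3;0;4;2;6;9;5;10;7;11;8];
  [:: 1;3;0;4;2;7;9;8;6;5]; [:: 1;3;0;4;2;7;9;8;5;10;6];
  [:: 1;3;0;4;2;6;8;10;5;11;7;9]; [:: 1;3;0;4;2;6;8;5;7;10;12;9;11];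
  [:: 1;2;4;0;3]; [:: 1;3;4;0;5;2]; [:: 1;2;4;6;0;3;5]; [:: 1;2;3;0;5;7;4;6];
  [:: 1;2;3;0;5;4]; [:: 1;2;3;0;5;6;4]; [:: 1;2;3;0;5;7;4;6];
  [:: 1;2;3;0;5;6;8;4;7]; [:: 1;2;3;0;5;6;4]; [:: 1;2;3;0;5;6;7;4];
  [:: 1;2;3;0;5;6;8;4;7]; [:: 1;2;3;0;5;7;8;4;9;6]; [:: 1;2;3;0;5;7;4;6];
  [:: 1;2;3;0;5;8;4;6;7]; [:: 1;2;3;0;6;7;4;9;5;8];
  [:: 1;2;3;0;6;7;4;9;5;10;8]; [:: 1;4;5;2;0;3]; [:: 1;2;3;5;6;0;4];
  [:: 1;2;3;0;5;7;4;6]; [:: 1;2;3;0;5;7;4;8;6]; [:: 1;2;3;4;0;6;5];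
  [:: 1;2;3;0;5;6;7;4]; [:: 1;2;3;0;5;6;8;4;7]; [:: 1;2;3;0;5;7;8;4;9;6];
  [:: 1;2;3;0;6;7;5;4]; [:: 1;2;3;0;6;7;5;8;4]; [:: 1;2;3;0;5;8;4;9;6;7];
  [:: 1;2;3;0;5;8;4;9;6;10;7]; [:: 1;2;3;0;6;8;7;5;4];
  [:: 1;2;3;0;6;8;7;4;9;5]; [:: 1;2;3;0;5;7;9;4;10;6;8];
  [:: 1;2;3;0;5;7;4;6;9;11;8;10]; [:: 1;2;3;0;5;6;4]; [:: 1;2;3;0;5;7;4;6];
  [:: 1;2;3;0;5;7;4;8;6]; [:: 1;2;3;0;6;8;4;5;9;7]; [:: 1;2;3;0;5;6;7;4];
  [:: 1;2;3;0;5;6;8;4;7]; [:: 1;2;3;0;5;7;9;4;6;8];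
  [:: 1;2;3;0;5;6;4;8;10;7;9]; [:: 1;2;3;0;5;7;8;6;4];
  [:: 1;2;3;0;5;6;4;8;9;7]; [:: 1;2;3;0;5;6;4;8;10;7;9];
  [:: 1;2;3;0;5;6;4;8;10;7;11;9]; [:: 1;2;3;0;5;6;4;9;7;8];
  [:: 1;2;3;0;5;6;4;8;9;10;7]; [:: 1;2;3;0;5;6;4;8;9;11;7;10];
  [:: 1;2;3;0;5;7;4;8;6;10;12;9;11]; [:: 1;2;3;0;5;6;7;4];
  [:: 1;2;3;0;5;6;8;4;7]; [:: 1;2;3;5;6;0;8;4;9;7];
  [:: 1;2;3;5;7;0;9;4;6;10;8]; [:: 1;2;3;0;5;6;7;8;4];
  [:: 1;2;3;5;6;0;7;9;4;8]; [:: 1;2;3;0;5;6;8;10;4;7;9];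
  [:: 1;2;3;0;5;6;7;4;9;11;8;10]; [:: 1;2;3;5;6;0;8;9;7;4];
  [:: 1;2;3;0;5;6;7;4;9;10;8]; [:: 1;2;3;0;5;6;7;4;9;11;8;10];
  [:: 1;2;3;0;5;6;7;4;9;11;8;12;10]; [:: 1;2;3;0;5;6;7;4;10;8;9];
  [:: 1;2;3;0;5;6;7;4;9;10;11;8]; [:: 1;2;3;0;5;6;7;4;9;10;12;8;11];
  [:: 1;2;3;0;5;6;9;4;10;7;12;8;13;11]; [:: 2;0;4;5;1;3]; [:: 2;0;4;5;1;6;3];
  [:: 2;0;4;5;1;7;3;6]; [:: 2;0;4;5;1;6;8;3;7]; [:: 2;0;4;5;1;6;3];
  [:: 2;0;4;5;1;6;7;3]; [:: 2;0;4;5;1;6;8;3;7]; [:: 2;0;4;5;1;3;7;9;6;8];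
  [:: 2;0;4;5;1;3;7;6]; [:: 2;0;4;5;1;3;7;8;6]; [:: 2;0;4;5;1;3;7;9;6;8];
  [:: 2;0;4;5;1;3;7;9;6;10;8]; [:: 2;0;4;5;1;3;7;8;6];
  [:: 2;0;4;5;1;3;7;8;9;6]; [:: 2;0;4;5;1;3;7;8;10;6;9];
  [:: 2;0;4;5;1;7;3;6;9;11;8;10]; [:: 2;0;5;4;6;1;3]; [:: 2;0;4;5;1;7;3;6];
  [:: 2;0;4;5;1;7;3;8;6]; [:: 2;0;4;5;1;7;9;3;6;8]; [:: 2;0;5;4;6;1;7;3];
  [:: 2;0;4;5;1;8;3;6;7]; [:: 2;0;4;5;1;9;7;6;3;8];
  [:: 2;0;4;5;1;8;3;10;6;7;9]; [:: 2;0;4;5;1;7;8;6;3];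
  [:: 2;0;4;5;1;7;8;3;9;6]; [:: 2;0;4;5;1;7;3;9;10;6;8];
  [:: 2;0;4;5;1;7;3;6;9;11;8;10]; [:: 2;0;4;5;1;8;9;3;7;6];
  [:: 2;0;4;5;1;7;9;8;3;10;6]; [:: 2;0;4;5;1;7;9;8;3;11;6;10];
  [:: 2;0;4;5;1;7;3;8;6;10;12;9;11]; [:: 2;0;4;5;1;6;7;3];
  [:: 2;0;4;5;1;6;8;3;7]; [:: 2;0;4;5;1;3;7;9;6;8];
  [:: 2;0;4;5;1;3;7;9;6;10;8]; [:: 2;0;4;5;1;6;3;8;7];
  [:: 2;0;4;5;1;3;7;8;9;6]; [:: 2;0;4;5;1;3;7;8;10;6;9];
  [:: 2;0;4;5;1;3;7;9;10;6;11;8]; [:: 2;0;4;5;1;3;8;9;7;6];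
  [:: 2;0;4;5;1;3;8;9;7;10;6]; [:: 2;0;4;5;1;3;7;10;6;11;8;9];
  [:: 2;0;4;5;1;3;7;10;6;11;8;12;9]; [:: 2;0;4;5;1;3;8;10;9;7;6];
  [:: 2;0;4;5;1;3;8;10;9;6;11;7]; [:: 2;0;4;5;1;3;7;9;11;6;12;8;10];
  [:: 2;0;4;5;1;3;7;9;6;8;11;13;10;12]; [:: 2;0;4;5;1;6;7;8;3];
  [:: 2;0;4;5;8;6;3;9;1;7]; [:: 2;0;4;5;1;6;3;8;10;7;9];
  [:: 2;0;4;5;1;6;3;8;10;7;11;9]; [:: 2;0;4;5;1;6;7;3;9;8];
  [:: 2;0;4;5;1;6;3;8;9;10;7]; [:: 2;0;4;5;1;6;3;8;9;11;7;10];
  [:: 2;0;4;5;1;6;3;8;10;11;7;12;9]; [:: 2;0;4;5;1;6;3;9;10;8;7];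
  [:: 2;0;4;5;1;6;3;9;10;8;11;7]; [:: 2;0;4;5;1;6;3;8;11;7;12;9;10];
  [:: 2;0;4;5;1;6;3;8;11;7;12;9;13;10]; [:: 2;0;4;5;1;6;3;9;11;10;8;7];
  [:: 2;0;4;5;1;6;3;9;11;10;7;12;8]; [:: 2;0;4;5;1;6;3;8;10;12;7;13;9;11];
  [:: 2;0;4;5;1;6;3;8;10;7;9;12;14;11;13]; [:: 2;4;3;0;6;1;5];
  [:: 1;3;0;2;5;7;4;6]; [:: 1;3;0;2;5;7;4;8;6]; [:: 1;3;0;2;5;7;9;4;6;8];
  [:: 2;4;3;0;5;1;7;6]; [:: 1;3;0;2;5;8;4;6;7]; [:: 1;3;0;2;5;9;7;6;4;8];
  [:: 1;3;0;2;5;8;4;10;6;7;9]; [:: 1;3;0;2;5;7;8;6;4];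
  [:: 1;3;0;2;5;7;8;4;9;6]; [:: 1;3;0;2;5;7;4;9;10;6;8];
  [:: 1;3;0;2;5;7;4;6;9;11;8;10]; [:: 1;3;0;2;5;8;9;4;7;6];
  [:: 1;3;0;2;5;7;9;8;4;10;6]; [:: 1;3;0;2;5;7;9;8;4;11;6;10];
  [:: 1;3;0;2;5;7;4;8;6;10;12;9;11]; [:: 1;3;0;2;5;6;7;4];
  [:: 1;3;0;2;5;6;8;4;7]; [:: 1;3;0;2;5;7;8;4;9;6];
  [:: 1;3;0;2;5;6;8;10;4;7;9]; [:: 1;3;0;2;5;6;7;8;4];
  [:: 1;3;0;2;5;8;9;6;4;7]; [:: 1;3;0;2;5;6;7;9;10;4;8];
  [:: 1;3;0;2;5;6;7;4;9;11;8;10]; [:: 1;3;0;2;5;7;8;4;9;6];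
  [:: 1;3;0;2;5;6;7;4;9;10;8]; [:: 1;3;0;2;5;6;7;4;9;11;8;10];
  [:: 1;3;0;2;5;6;7;4;9;11;8;12;10]; [:: 1;3;0;2;5;6;7;4;10;8;9];
  [:: 1;3;0;2;5;6;7;4;9;10;11;8]; [:: 1;3;0;2;5;6;7;4;9;10;12;8;11];
  [:: 1;3;0;2;5;6;7;9;10;4;12;8;13;11]; [:: 1;3;0;2;6;7;5;8;4];
  [:: 1;3;0;2;5;8;4;9;6;7]; [:: 1;3;0;2;5;8;4;9;6;10;7];
  [:: 1;3;0;2;5;8;4;10;6;7;11;9]; [:: 1;3;0;2;6;7;5;4;9;8];
  [:: 1;3;0;2;5;8;9;10;4;6;7]; [:: 1;3;0;2;5;8;4;9;6;11;7;10];
  [:: 1;3;0;2;5;8;4;9;6;11;7;12;10]; [:: 1;3;0;2;5;8;4;9;6;10;7];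
  [:: 1;3;0;2;5;8;4;9;6;10;11;7]; [:: 1;3;0;2;5;8;4;9;6;10;12;7;11];
  [:: 1;3;0;2;5;8;4;9;6;7;11;13;10;12]; [:: 1;3;0;2;5;8;4;9;6;10;11;7];
  [:: 1;3;0;2;5;8;4;9;6;10;11;12;7]; [:: 1;3;0;2;5;8;4;10;6;12;7;13;9;11];
  [:: 1;3;0;2;5;8;4;9;6;10;7;12;14;11;13]; [:: 1;3;0;2;6;8;7;4;9;5];
  [:: 1;3;0;2;5;7;9;4;10;6;8]; [:: 1;3;0;2;5;7;4;6;9;11;8;10];
  [:: 1;3;0;2;5;7;4;6;9;11;8;12;10]; [:: 1;3;0;2;5;9;7;8;10;4;6];
  [:: 1;3;0;2;5;7;4;6;9;10;11;8]; [:: 1;3;0;2;5;7;4;6;9;10;12;8;11];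
  [:: 1;3;0;2;5;7;4;6;9;11;12;8;13;10]; [:: 1;3;0;2;5;7;4;6;10;11;9;8];
  [:: 1;3;0;2;5;7;4;6;10;11;9;12;8]; [:: 1;3;0;2;5;7;4;6;9;12;8;13;10;11];
  [:: 1;3;0;2;5;7;4;6;9;12;8;13;10;14;11]; [:: 1;3;0;2;5;7;4;6;10;12;11;9;8];
  [:: 1;3;0;2;5;7;4;6;10;12;11;8;13;9];
  [:: 1;3;0;2;5;7;4;6;9;11;13;8;14;10;12];
  [:: 1;3;0;2;5;7;4;6;9;11;8;10;13;15;12;14]].

Lemma pair_certificates : all2 (comb_ok sib_dist sib_move) (words 3 2) pair_table.
Proof. by vm_compute. Qed.

Lemma triple_certificates :
  all2 (comb_ok sib_dist sib_move) (words 3 3) triple_table.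
Proof. by vm_compute. Qed.

Lemma path_certificates :
  all2 (comb_ok path_dist path_move) (words 4 4) path_table.
Proof. by vm_compute. Qed.

(** * The type of a vertex *)

Section Main.
Variables (V : finType) (e : rel V) (x : V) (par : V -> V) (rk : V -> nat).
Hypothesis sym_e : symmetric e.
Hypothesis parx : par x = x.
Hypothesis rk_par : forall v, v != x -> rk (par v) < rk v.
Hypothesis eE : forall a b,
  e a b = (a != x) && (par a == b) || (b != x) && (par b == a).
Notation kids := (kids x par).
Notation desc := (desc par).
Notation descs := (descs par).
Notation placeable := (placeable e x par).
Notation leg := (leg e x par).

(** The siblings serve as the spine: they are pairwise non-adjacent and joined by walks of length 2
    through [v], which stays outside the comb. *)
Lemma placeable_siblings v S l t : uniq S -> {subset S <= kids v} ->
  {in S, forall c, leg (l c) c (kids c)} ->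
  comb_ok sib_dist sib_move (map l S) t -> placeable v S.
Proof.
move=> uS Sv legS ok.
have kidS i : i < size S -> nth x S i \in kids v by move=> /(mem_nth x)/Sv.
have Sx i : i < size S -> nth x S i != x /\ par (nth x S i) = v.
  by move=> /kidS; rewrite mem_kids => /andP[-> /eqP].
have rkS c : c \in S -> rk v < rk c by move=> /Sv; apply: kids_rk.
have near i k : i < size S -> k < size S -> within e 2 (nth x S i) (nth x S k).
  move=> iS kS; apply: (@within_trans _ _ 1 1 _ v).
    by rewrite within_sym //; apply/within1/(kids_edge eE)/kidS.
  exact/within1/(kids_edge eE)/kidS.
have clS : top_closed par rk [set w in S].
  move=> c; rewrite inE => cS; right=> w; rewrite inE => wS.
  by move: (Sv c cS); rewrite mem_kids => /andP[_ /eqP->]; apply/ltnW/rkS.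
have dP i k : i < size S -> k < size S -> i != k ->
    [/\ 0 < sib_dist i k, e (nth x S i) (nth x S k) = (sib_dist i k == 1)
      & within e (sib_dist i k) (nth x S i) (nth x S k)].
  move=> iS kS nik; split=> //; last exact: near.
  have [ix pi] := Sx i iS; have [kx pk] := Sx k kS; rewrite eE ix kx pi pk /=.
  have neq j : j < size S -> (v == nth x S j) = false.
    by move=> jS; apply: contraTF (rkS _ (mem_nth x jS)) => /eqP<-; rewrite ltnn.
  by rewrite !neq.
have lP : {in S, forall c, leg (l c) c [seq d <- kids c | d \notin S]}.
  move=> c cS; suff -> : [seq d <- kids c | d \notin S] = kids c by apply: legS.
  apply/all_filterP/allP => d dc; apply/negP => dS; have := rkS c cS.
  move: (Sv d dS) dc; rewrite !mem_kids => /andP[-> /eqP->] /eqP->.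
  by rewrite ltnn.
have mS i q w : i < size S -> q.1 < size S -> sib_move (i, 0) q ->
    within e q.2 (nth x S q.1) w -> moves_ok e x (nth x S i) w.
  move=> iS qS /andP[_ /= q1] wq; have [ix _] := Sx i iS.
  have w3 : within e 3 (nth x S i) w.
    exact: (within_trans (near i q.1 iS qS) (within_leq q1 wq)).
  by split=> [|//|ix']; [apply: within_leq w3|rewrite ix' eqxx in ix].
have mL i j q : i < size S -> q.1 < size S -> sib_move (i, j.+1) q ->
    comb_dist sib_dist (i, j.+1) q <= 4 /\
    (nth x S i = x -> j = 0 -> comb_dist sib_dist (i, j.+1) q <= 3).
  move=> iS _ /andP[d4 _]; split=> // ix'.
  by have [] := Sx i iS; rewrite ix' eqxx.
have [h [ph hS]] := core_placement sym_e parx rk_par eE uS clS dP lP ok mS mL.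
exists h; split=> // c cS; have := hS (index c S).
rewrite index_mem nth_index // => /(_ cS)[q [qS /andP[_ /= q1] wq]].
apply: (@within_trans _ _ 1 1 _ (nth x S q.1)); last exact: within_leq wq.
exact/within1/(kids_edge eE)/kidS.
Qed.

(** Sizes 2 and 3 are in the tables. From size 4 on, two children are split off and at least two
    remain, so size 1 never arises. *)
Lemma placeable_short v S l : uniq S -> {subset S <= kids v} ->
  {in S, forall c, l c < 3 /\ leg (l c) c (kids c)} -> size S != 1 -> placeable v S.
Proof.
have [n] := ubnP (size S); elim: n S => // n IHn S ltn uS Sv lS S1.
have legS : {in S, forall c, leg (l c) c (kids c)} by move=> c /lS[].
have wS : map l S \in words 3 (size S).
  by apply: mem_words; rewrite ?size_map // all_map; apply/allP => c /lS[].
case: S S1 ltn uS Sv lS legS wS => [|a [|b [|c [|d S]]]] // _ ltn uS Sv lS legS wS.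
- exact: placeable0.
- have [t ok] := all2_mem pair_certificates wS.
  exact: placeable_siblings legS ok.
- have [t ok] := all2_mem triple_certificates wS.
  exact: placeable_siblings legS ok.
have sub (K : seq V) : {subset K <= [:: a, b, c, d & S]} ->
    {subset K <= kids v} /\ {in K, forall c, l c < 3 /\ leg (l c) c (kids c)}.
  by move=> Ksub; split=> u /Ksub; [apply: Sv|apply: lS].
have := uS; rewrite -[_ :: _]/([:: a; b] ++ [:: c, d & S]) cat_uniq => /and3P[u1 _ u2].
have [|s1 l1] := sub [:: a; b]; first by move=> u; rewrite !inE => /orP[]->; rewrite ?orbT.
have [|s2 l2] := sub [:: c, d & S].
  by move=> u us; rewrite 2!inE us !orbT.
apply: (placeable_cat sym_e parx rk_par eE) => //; by apply: IHn => //=; move: ltn => /=; lia.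
Qed.

Lemma placeable_long v S : uniq S -> {subset S <= kids v} ->
  {in S, forall c, leg 3 c (kids c)} -> placeable v S.
Proof.
elim: S => [|c S IHS]; first by move=> *; apply: placeable0.
move=> uS Sv legS.
apply: (placeable_cat (K := [:: c]) sym_e parx rk_par eE) => //.
  (* A single spine vertex with a leg of length 3 is a path with four vertices, here moved along one
     4-cycle. *)
  apply: (@placeable_siblings _ _ (fun=> 3) [:: 1; 3; 0; 2]) => // d.
    by rewrite inE => /eqP->; apply/Sv/mem_head.
  by rewrite inE => /eqP->; apply/legS/mem_head.
apply: IHS; first by case/andP: uS.
  by move=> d dS; apply: Sv; rewrite inE dS orbT.
by move=> d dS; apply: legS; rewrite inE dS orbT.
Qed.

(** Induction towards the root, on the gap to the maximal rank. If exactly one child has a type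
    [k < 3], removing it gives type [k+1]; otherwise all children are placed and the type is 0. *)
Lemma leg_exists v K : uniq K -> {subset K <= kids v} ->
  exists2 k, k <= 3 & leg k v K.
Proof.
have [n] := ubnP (\max_w rk w - rk v); elim: n v K => // n IHn v K ltn uK Kv.
have [|l lK] := @seq_choice _ _ 0 K (fun c k => k <= 3 /\ leg k c (kids c)).
  move=> c cK; have [||k k3 lk] := IHn c (kids c) _ (kids_uniq _ _ _) _ => //.
    by have := kids_rk rk_par (Kv c cK); have := @leq_bigmax _ rk c; lia.
  by exists k.
pose bs := [seq c <- K | l c < 3]; pose gs := [seq c <- K | 3 <= l c].
have pgs : placeable v gs.
  apply: placeable_long; rewrite ?filter_uniq // => c; rewrite mem_filter => /andP[l3 cK].
    exact: Kv.
  have [le3 lc] := lK c cK.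
  by have -> : 3 = l c by apply/eqP; rewrite eqn_leq l3.
have uE : perm_eq (bs ++ gs) K.
  have -> : gs = filter (predC (fun c => l c < 3)) K.
    by apply: eq_filter => c /=; rewrite leqNgt.
  exact/permPl/perm_filterC.
have [/eqP|bs1] := boolP (size bs == 1).
  case Ebs: bs => [|c [|//]] // _.
  have : c \in bs by rewrite Ebs mem_head.
  rewrite mem_filter => /andP[lc cK]; exists (l c).+1 => //=.
  exists c => //; split; last by have [] := lK c cK.
  apply: placeable_eq pgs => d; rewrite (mem_rem_uniq _ uK) inE /=.
  have := perm_mem uE d; rewrite Ebs inE => <-.
  case: eqVneq => [->|//]; by rewrite mem_filter leqNgt lc.
exists 0 => //=; apply: placeable_eq (perm_mem uE) _.
apply: (placeable_cat sym_e parx rk_par eE) => //.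
- by move=> c; rewrite (perm_mem uE); apply: Kv.
- by rewrite (perm_uniq uE).
apply: (@placeable_short _ _ l) => //; first by rewrite filter_uniq.
  by move=> c; rewrite mem_filter => /andP[_ /Kv].
by move=> c; rewrite mem_filter => /andP[l3 /lK[]].
Qed.

(** * The initial path and the placement of the whole tree *)

Definition root_path a b c d :=
  [/\ uniq [:: a; b; c; d], x \in [:: a; b], top_closed par rk [set w in [:: a; b; c; d]]
    & [/\ e a b, e b c, e c d & [/\ ~~ e a c, ~~ e a d & ~~ e b d]]].

(** Some [u] has depth 2, with parent [v], or else [x] is the centre of a star. A second child [w]
    of [x] gives the path [w, x, v, u]; otherwise a vertex [w] of depth 3 gives [x, v, par w, w]. If
    neither exists, [v] is the centre of a star. *)
Lemma root_path_exists : ~ is_star e -> exists a b c d, root_path a b c d.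
Proof.
move=> nstar.
have par_neq v : v != x -> par v != v.
  by move=> /rk_par; apply: contraTneq => ->; rewrite ltnn.
have eN a b : par a != b -> par b != a -> ~~ e a b.
  by move=> /negPf ab /negPf ba; rewrite eE ab ba !andbF.
have eP a : a != x -> e (par a) a by rewrite eE => ->; rewrite eqxx orbT.
have [/existsP[u0 /andP[u0x pu0x]]|/existsPn depth1] :=
  boolP [exists u, (u != x) && (par u != x)]; last first.
  have kid u : u != x -> par u = x.
    by move=> ux; have := depth1 u; rewrite ux negbK => /eqP.
  case: nstar; exists x => u v; rewrite eE.
  have [->|ux] := eqVneq u x; have [->|vx] := eqVneq v x; rewrite ?parx ?kid ?eqxx //=.
  by rewrite ![x == _]eq_sym (negPf ux) (negPf vx).
have [u [v [ux vx pu pv]]] : exists u v, [/\ u != x, v != x, par u = v & par v = x].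
  elim/(rank_ind rk_par): u0 u0x pu0x => u IHu ux pux.
  have [ppu|ppux] := eqVneq (par (par u)) x; first by exists u, (par u).
  exact: IHu.
have uv : u != v by rewrite eq_sym -pu par_neq.
have [/existsP[w /and3P[wx wv /eqP pw]]|/existsPn onekid] :=
  boolP [exists w, [&& w != x, w != v & par w == x]].
  have wu : w != u by apply: contraNneq vx => wu; rewrite -pu -wu pw.
  exists w, x, v, u; split; rewrite ?inE ?eqxx ?orbT //=.
  - by rewrite !inE !negb_or wx wv wu ![x == _]eq_sym vx ux [v == u]eq_sym uv.
  - move=> z; rewrite !inE => /or4P[] /eqP->; left; rewrite ?pw ?pu ?parx ?pv ?eqxx ?orbT //.
  - split; [by rewrite sym_e -{1}pw eP|by rewrite -{1}pv eP|by rewrite -{1}pu eP|].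
    by split; apply: eN; rewrite ?pw ?pu ?pv ?parx // 1?eq_sym //.
have [/existsP[w /and4P[wx pwx pwv /eqP ppw]]|/existsPn twolevels] :=
  boolP [exists w, [&& w != x, par w != x, par w != v & par (par w) == v]].
  have wu : w != par w by rewrite eq_sym par_neq.
  have wv : w != v by apply: contraNneq pwx => ->; rewrite pv.
  exists x, v, (par w), w; split; rewrite ?inE ?eqxx ?orbT //=.
  - by rewrite !inE !negb_or ![x == _]eq_sym vx pwx wx ![v == _]eq_sym pwv wv [_ == w]eq_sym wu.
  - move=> z; rewrite !inE => /or4P[] /eqP->; left; rewrite ?ppw ?pu ?parx ?pv ?eqxx ?orbT //.
  - split; [by rewrite -{1}pv eP|by rewrite -{1}ppw eP|by rewrite eP|].
    by split; apply: eN; rewrite ?parx ?pu ?pv ?ppw // 1?eq_sym //.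
case: nstar; exists v.
have lvl z : [\/ z = x, z = v | par z = v].
  elim/(rank_ind rk_par): z => z IHz.
  have [->|zx] := eqVneq z x; first by constructor 1.
  have [pzx|pzx] := eqVneq (par z) x.
    constructor 2; apply/eqP; have := onekid z.
    by rewrite zx pzx eqxx andbT /= negbK.
  have [pzv|pzv] := eqVneq (par z) v; first by constructor 3.
  case: (IHz zx) => [pz|pz|pz]; [by rewrite pz eqxx in pzx|by rewrite pz eqxx in pzv|].
  by have := twolevels z; rewrite zx pzx pzv pz eqxx.
have lvl' z : z != v -> z != x -> par z = v.
  by case: (lvl z) => [->|->|//]; rewrite eqxx.
move=> a b; rewrite eE; have [->|av] := eqVneq a v; have [->|bv] := eqVneq b v => /=.
- by rewrite (negPf (par_neq v vx)) andbF.
- rewrite pv vx /=; have [->|bx] := eqVneq b x; first by [].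
  by rewrite lvl' ?eqxx ?orbT.
- rewrite pv vx /=; have [->|ax] := eqVneq a x; first by rewrite ?orbT.
  by rewrite lvl' ?eqxx ?orbT.
- have [->|ax] := eqVneq a x; have [->|bx] := eqVneq b x; rewrite ?parx ?lvl' //=.
  + by rewrite (negPf vx).
  + by rewrite (negPf vx).
  + by rewrite ![v == _]eq_sym (negPf av) (negPf bv) ?andbF.
Qed.

Lemma rooted_placement : ~ is_star e -> exists f, placement e x setT f.
Proof.
move/root_path_exists=> [a [b [c [d [uS xS clS [eab ebc ecd [eac ead ebd]]]]]]].
pose S := [:: a; b; c; d].
have [|l lS] := @seq_choice _ _ 0 S
    (fun v k => k <= 3 /\ leg k v [seq w <- kids v | w \notin S]).
  (* Types are computed without the children on the path, which already belong to the spine. *)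
  move=> v _; have [||k k3 lk] := @leg_exists v [seq w <- kids v | w \notin S].
  - exact/filter_uniq/kids_uniq.
  - by move=> w; rewrite mem_filter => /andP[].
  by exists k.
have wS : map l S \in words 4 4.
  by apply: mem_words => //; rewrite all_map; apply/allP => v /lS[].
have [t ok] := all2_mem path_certificates wS.
have dS i k : i < size S -> k < size S ->
    e (nth x S i) (nth x S k) = (path_dist i k == 1)
    /\ within e (path_dist i k) (nth x S i) (nth x S k).
  have eN u w : ~~ e u w -> e w u = false by rewrite sym_e => /negPf.
  have eSd v : e v v = false.
    by rewrite eE orbb; apply/negP => /andP[vx /eqP pv]; have := rk_par vx; rewrite pv ltnn.
  have [eba ecb edc] : [/\ e b a, e c b & e d c] by split; rewrite sym_e.
  have wb := within1 ebc; have wab := within1 eab; have wcd := within1 ecd.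
  have wac := within_trans wab wb; have wbd := within_trans wb wcd.
  have wad := within_trans wac wcd.
  case: i => [|[|[|[|i]]]] //; case: k => [|[|[|[|k]]]] // _ _; split;
    first [ by rewrite /= ?eSd ?eab ?ebc ?ecd ?eba ?ecb ?edc ?(negPf eac)
              ?(negPf ead) ?(negPf ebd) ?(eN _ _ eac) ?(eN _ _ ead) ?(eN _ _ ebd)
          | exact: within_refl
          | first [exact: wab|exact: wb|exact: wcd|exact: wac|exact: wbd|exact: wad]
          | rewrite within_sym //;
            first [exact: wab|exact: wb|exact: wcd|exact: wac|exact: wbd|exact: wad] ].
have xS01 : x = nth x S 0 \/ x = nth x S 1.
  by move: xS; rewrite !inE => /orP[]/eqP; [left|right].
have dP i k : i < size S -> k < size S -> i != k ->
    [/\ 0 < path_dist i k, e (nth x S i) (nth x S k) = (path_dist i k == 1)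
      & within e (path_dist i k) (nth x S i) (nth x S k)].
  by move=> iS kS nik; have [? ?] := dS i k iS kS; split=> //;
    rewrite addn_gt0 !subn_gt0 orbC -neq_ltn.
have inj i k : i < 4 -> k < 4 -> nth x S i = nth x S k -> i = k.
  by move=> i4 k4 /eqP; rewrite nth_uniq // => /eqP.
have mS i q w : i < size S -> q.1 < size S -> path_move (i, 0) q ->
    within e q.2 (nth x S q.1) w -> moves_ok e x (nth x S i) w.
  move=> iS qS mq wq.
  have wd : within e (comb_dist path_dist (i, 0) q) (nth x S i) w.
    rewrite /comb_dist /=; case: eqVneq => [iq|_].
      by rewrite sub0n subn0 add0n iq.
    by apply: within_trans wq; have [] := dS i q.1 iS qS.
  move: mq; rewrite /path_move /= => mq; split.
  - by apply: within_leq wd; apply: leq_trans mq _; case: ifP => // _; case: ifP.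
  - move=> exi; apply: within_leq wd; apply: leq_trans mq _.
    (* As [x] has position 0 or 1, its neighbours on the path have position at most 2, where
       [path_move] allows at most 3. *)
    have : path_dist 0 i == 1 \/ path_dist 1 i == 1.
      case: xS01 => xi; [left|right]; move: exi; rewrite {1}xi.
        by have [-> _] := dS 0 i isT iS.
      by have [-> _] := dS 1 i isT iS.
    by case: i iS {exi} => [|[|[|[|i]]]] // _ [].
  move=> xi; apply: within_leq wd; apply: leq_trans mq _; rewrite ifT // andbT.
  by case: xS01 => xi'; rewrite (inj _ _ iS _ (etrans xi xi')).
have mL i j q : i < size S -> q.1 < size S -> path_move (i, j.+1) q ->
    comb_dist path_dist (i, j.+1) q <= 4 /\
    (nth x S i = x -> j = 0 -> comb_dist path_dist (i, j.+1) q <= 3).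
  move=> iS _; rewrite /path_move /= andbF => mq; split.
    by apply: leq_trans mq _; case: ifP.
  move=> xi j0; apply: leq_trans mq _; rewrite ifT // j0 andbT.
  by case: xS01 => xi'; rewrite (inj _ _ iS _ (etrans xi xi')).
have lP : {in S, forall v, leg (l v) v [seq w <- kids v | w \notin S]}.
  by move=> v /lS[].
have [h [ph _]] := core_placement sym_e parx rk_par eE uS clS dP lP ok mS mL.
exists h; suff <- : descs S = setT by [].
(* The path contains the root, so its descendants are all the vertices. *)
apply/setP => w; rewrite [RHS]inE; apply/descsP; exists x; last exact: (desc_root rk_par).
by move: xS; rewrite !inE => /orP[]->; rewrite ?orbT.
Qed.

End Main.

Theorem theorem1p7 (V : finType) (e : rel V) (x : V) :
  non_star_tree e -> exists s : {perm V}, well_2_placement e x s.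
Proof.
move=> [tree_e nstar]; have [[sym_e _] _] := tree_e.
have [par [rk [_ parx rk_par eE]]] := tree_rooting x tree_e.
have [|u v|f pf] := @rooted_placement _ e x par rk sym_e parx _ _ nstar.
- by move=> v /(rk_par v (in_setT v))[].
- exact: eE.
exact: placement_well pf.
Qed.
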